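(* Let $K$ and $L$ be finite simple graphs sharing exactly one vertex $v$ and otherwise disjoint, and let $G=K\vee_v L$ be their wedge at $v$. Then $$\operatorname{arb}(G)=\max\{\operatorname{arb}(K),\operatorname{arb}(L)\},$$ where $\operatorname{arb}$ denotes the reduced arboricity.
   Context: All graphs are finite and simple. A forest is a graph containing no cycles. Reduced arboricity: for a graph $G$ with $E(G)\neq\varnothing$, let $k$ be the minimum number of forests whose edge sets partition $E(G)$, and set $\operatorname{arb}(G)=k-1$ (so it is one less than the classical arboricity). If $E(G)=\varnothing$, set $\operatorname{arb}(G)=0$. Wedge: if $K$ and $L$ are graphs sharing exactly one vertex $v$ and otherwise disjoint, then $K\vee_v L$ is their union, i.e. the graph with vertex set $V(K)\cup V(L)$ and edge set $E(K)\cup E(L)$ (the two copies of $v$ being identified). *)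

(* Defs.v *)
From HB Require Import structures.
From mathcomp Require Import all_boot.

Set Implicit Arguments.
Unset Strict Implicit.
Unset Printing Implicit Defensive.

(* A finite simple graph is a pair (vertex set, edge set) inside an ambient
   finite type [T] of potential vertices, so that two graphs may share some
   vertices.  An edge is a two-element subset of the vertex set. *)
Definition simple_graph (T : finType) (p : {set T} * {set {set T}}) : bool :=
  [forall e in p.2, (e \subset p.1) && (#|e| == 2)].

Record sgraph (T : finType) := SGraph {
  sgraph_val :> {set T} * {set {set T}};
  sgraphP : simple_graph sgraph_val
}.

HB.instance Definition _ (T : finType) := [isSub for @sgraph_val T].
HB.instance Definition _ (T : finType) := [Finite of sgraph T by <:].

Section Graphs.
Variable T : finType.
Implicit Types (G K L F : sgraph T) (P : {set {set {set T}}}).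

Definition verts G : {set T} := (sgraph_val G).1.
Definition edges G : {set {set T}} := (sgraph_val G).2.

Lemma edges_sub G e : e \in edges G -> e \subset verts G.
Proof. by move=> eG; have /forall_inP/(_ e eG)/andP[] := sgraphP G. Qed.

Lemma edges_card G e : e \in edges G -> #|e| = 2.
Proof. by move=> eG; have /forall_inP/(_ e eG)/andP[_ /eqP] := sgraphP G. Qed.

Definition adj G : rel T := fun x y => [set x; y] \in edges G.

(* A cycle is a cyclic sequence of at least three distinct vertices in which
   successive vertices are adjacent. *)
Definition graph_cycle G (c : seq T) : bool := (2 < size c) && ucycleb (adj G) c.

(* Bounding the length by [#|T|] loses nothing, by uniqueness of the vertices
   of a cycle (see [is_forestP]); it makes the property boolean. *)
Definition is_forest G : bool :=
  [forall n : 'I_#|T|.+1, [forall c : n.-tuple T, ~~ graph_cycle G c]].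

Lemma is_forestP G : reflect (forall c : seq T, ~ graph_cycle G c) (is_forest G).
Proof.
apply: (iffP forallP) => [noC c Cc | noC n]; last first.
  by apply/forallP => c; apply/negP/noC.
have Uc : uniq c by case/andP: Cc => _ /andP[].
have lt_c : size c < #|T|.+1 by rewrite ltnS -(card_uniqP Uc) max_card.
by have /forallP/(_ (in_tuple c))/negP := noC (Ordinal lt_c).
Qed.

(* The blocks of [P] are nonempty and pairwise disjoint with union [edges G];
   each of them is the edge set of some forest. *)
Definition forest_partition G P : bool :=
  partition P (edges G) &&
  [forall B in P, [exists F : sgraph T, is_forest F && (edges F == B)]].

Definition forest_decomposable G (k : nat) : bool :=
  [exists P, forest_partition G P && (#|P| == k)].

Lemma simple_graph1 (e : {set T}) : #|e| = 2 -> simple_graph (e, [set e]).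
Proof.
by move=> e2; apply/forall_inP => f /set1P ->; rewrite subxx e2 eqxx.
Qed.

Lemma forest1 (e : {set T}) (e2 : #|e| = 2) : is_forest (SGraph (simple_graph1 e2)).
Proof.
apply/is_forestP => -[|x [|y [|z c]]] //= /andP[_ /andP[]] /=.
case/and3P => /set1P exy /set1P eyz _ /and3P[xNyz _ _].
have : x \in [set y; z] by rewrite eyz -exy set21.
by rewrite !inE in xNyz *; case/norP: xNyz => /negPf-> /norP[/negPf->].
Qed.

Lemma ex_forest_decomposable G : exists k, forest_decomposable G k.
Proof.
pose P := [set [set e] | e in edges G].
exists #|P|; apply/existsP; exists P; rewrite eqxx andbT; apply/andP; split.
  apply/and3P; split.
  - apply/eqP/setP => e; apply/bigcupP/idP => [[_ /imsetP[f fG ->]] /set1P-> //|eG].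
    by exists [set e]; rewrite ?set11 ?imset_f.
  - apply/trivIsetP => _ _ /imsetP[e _ ->] /imsetP[f _ ->] ne_ef.
    by rewrite disjoints1 inE; apply: contraNneq ne_ef => ->.
  - by apply/negP => /imsetP[e _ /setP/(_ e)]; rewrite !inE eqxx.
apply/forall_inP => _ /imsetP[e /edges_card e2 ->].
by apply/existsP; exists (SGraph (simple_graph1 e2)); rewrite forest1 eqxx.
Qed.

Definition min_forests G : nat := ex_minn (ex_forest_decomposable G).

(* Reduced arboricity: one less than the classical arboricity. *)
Definition arb G : nat := if edges G == set0 then 0 else min_forests G - 1.

Lemma simple_graphU K L :
  simple_graph (verts K :|: verts L, edges K :|: edges L).
Proof.
apply/forall_inP => e /setUP[] eKL; rewrite (edges_card eKL) eqxx andbT.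
  exact: subset_trans (edges_sub eKL) (subsetUl _ _).
exact: subset_trans (edges_sub eKL) (subsetUr _ _).
Qed.

(* When [verts K :&: verts L = [set v]] this is the wedge of [K] and [L] at
   [v]. *)
Definition graph_union K L : sgraph T := SGraph (simple_graphU K L).

End Graphs.

(* Main.v *)
Require Import Defs.
From mathcomp Require Import all_boot.

(** Encode a partition into at most [k] forests as a colouring of the edges by
    [k] colours with acyclic colour classes.  A colouring of the wedge is a pair
    of colourings of [K] and [L], because a cycle of the wedge passes through
    [v] at most once and hence lies entirely in [K] or in [L]. *)

Section WedgeArboricity.
Set Implicit Arguments.
Unset Strict Implicit.
Variable T : finType.
Implicit Types (F G K L : sgraph T) (X : {set {set T}}) (k : nat).

Lemma is_forest_sub F G : edges F \subset edges G -> is_forest G -> is_forest F.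
Proof.
move=> sFG /is_forestP noC; apply/is_forestP => c /andP[c3 /andP[Cc Uc]].
apply: (noC c); rewrite /graph_cycle c3 /ucycleb Uc andbT.
by apply: sub_cycle Cc => x y; apply: (subsetP sFG).
Qed.

Lemma adj_sym G : symmetric (adj G).
Proof. by move=> x y; rewrite /adj setUC. Qed.

Lemma adj_neq G x y : adj G x y -> x != y.
Proof. by move/edges_card; rewrite cards2; case: (x != y). Qed.

Lemma adj_verts G x y : adj G x y -> (x \in verts G) && (y \in verts G).
Proof. by move/edges_sub; rewrite subUset !sub1set. Qed.

Lemma adj_union K L x y : adj (graph_union K L) x y = adj K x y || adj L x y.
Proof. by rewrite /adj /edges /= inE. Qed.

Lemma graph_unionC K L : graph_union K L = graph_union L K.
Proof. by apply/val_inj; rewrite /= [verts K :|: _]setUC [edges K :|: _]setUC. Qed.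

Section Wedge.
Variables (K L : sgraph T) (v : T).
Hypothesis KL_v : verts K :&: verts L \subset [set v].

(** An edge of [L] at [x] would put [x] in both vertex sets and force [x = v]. *)
Lemma wedge_adjl x y : x != v -> x \in verts K ->
  adj (graph_union K L) x y -> adj K x y.
Proof.
move=> xv xK; rewrite adj_union => /orP[//|/adj_verts/andP[xL _]].
by case/negP: xv; rewrite -in_set1 (subsetP KL_v) // inE xK.
Qed.

(** A walk can leave [K] only through [v]. *)
Lemma wedge_path_verts x p : v \notin x :: p -> x \in verts K ->
  path (adj (graph_union K L)) x p -> all [in verts K] (x :: p).
Proof.
elim: p x => [|y p IHp] x /=; first by move=> _ ->.
rewrite in_cons negb_or eq_sym => /andP[xv vp] xK /andP[xy yp].
have /adj_verts/andP[_ yK] := wedge_adjl xv xK xy.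
by rewrite xK; apply: IHp.
Qed.

(** Only the head [x] may equal [v], so the side of its successor [y] decides the side of the whole
    cycle. *)
Lemma wedge_cyclel x y p : v \notin y :: p -> y \in verts K ->
  graph_cycle (graph_union K L) (x :: y :: p) -> graph_cycle K (x :: y :: p).
Proof.
move=> vp yK /andP[c3 /andP[Cc Uc]]; rewrite /graph_cycle c3 /ucycleb Uc andbT.
have [xy yp] : adj (graph_union K L) x y /\ path (adj (graph_union K L)) y p.
  by move: Cc; rewrite /= rcons_path => /and3P[].
have yv : y != v by move: vp; rewrite in_cons negb_or eq_sym => /andP[].
have xK : x \in verts K.
  by rewrite adj_sym in xy; have /adj_verts/andP[] := wedge_adjl yv yK xy.
apply: (sub_in_cycle (P := [in verts K])) Cc; last first.
  by rewrite [all _ _]/= xK; apply: wedge_path_verts.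
(* Adjacent vertices are distinct, so at least one end of the edge differs from [v]; the edge is
   read from that end. *)
move=> a b /= aK bK ab; have [av|av] := eqVneq a v; last exact: wedge_adjl ab.
have bv : b != v by rewrite -av eq_sym (adj_neq ab).
by rewrite adj_sym; apply: wedge_adjl => //; rewrite adj_sym.
Qed.

End Wedge.

Lemma wedge_forest K L v : verts K :&: verts L \subset [set v] ->
  is_forest K -> is_forest L -> is_forest (graph_union K L).
Proof.
move=> KL_v /is_forestP noK /is_forestP noL; apply/is_forestP => c.
(* If [v] is on the cycle, rotate it to the head; uniqueness then keeps it out of the tail. *)
wlog [x [p ->{c} vp]] : c / exists x, exists2 p, c = x :: p & v \notin p.
  move=> IH; have [vc|vc] := boolP (v \in c); last first.
    case: c vc => [|x p]; first by move=> _ /andP[].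
    rewrite in_cons negb_or => /andP[_ vp].
    by apply: IH; exists x, p.
  move=> /andP[c3 /andP[Cc Uc]]; have [i p def_c] := rot_to vc.
  apply: (IH (rot i c)).
    exists v, p => //; move: Uc.
    by rewrite -(rot_uniq i) def_c => /andP[].
  by rewrite /graph_cycle size_rot c3 /ucycleb rot_cycle rot_uniq Cc.
case: p vp => [|y p] vp Cxp; first by case/andP: Cxp.
have xy : adj (graph_union K L) x y.
  by case/andP: Cxp => _ /andP[] /= /andP[].
rewrite adj_union in xy; case/orP: xy => /adj_verts/andP[_ yV].
  exact: noK (wedge_cyclel KL_v vp yV Cxp).
rewrite graph_unionC in Cxp; rewrite setIC in KL_v.
exact: noL (wedge_cyclel KL_v vp yV Cxp).
Qed.

Lemma simple_graph_restrict G X : simple_graph (verts G, edges G :&: X).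
Proof.
by apply/forall_inP => e /setIP[eG _]; rewrite /= edges_sub // (edges_card eG).
Qed.

(** All of [verts G] is kept, so that restrictions of [K] and [L] still meet at most in [v]. *)
Definition restrict G X : sgraph T := SGraph (simple_graph_restrict G X).

(** Unlike the blocks of a partition, colour classes may be empty, which makes this property
    monotone in [k]. *)
Definition forest_colorable G k : Prop := exists f : {set T} -> nat,
  {in edges G, forall e, f e < k} /\
  forall i, i < k -> is_forest (restrict G [set e | f e == i]).

Lemma decomposable_colorable G k : forest_decomposable G k -> forest_colorable G k.
Proof.
case/existsP => P /andP[/andP[partP /forall_inP forP] /eqP cardP].
have covP := cover_partition partP; have [_ tiP _] := and3P partP.
(* The colour of an edge is the position of its block in an enumeration of [P]. *)
exists (fun e => index (pblock P e) (enum P)); split=> [e eG | i ltik].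
  by rewrite -cardP cardE index_mem mem_enum pblock_mem ?covP.
have BP : nth set0 (enum P) i \in P by rewrite -mem_enum mem_nth // -cardE cardP.
have /existsP[F /andP[forF /eqP defF]] := forP _ BP.
apply: is_forest_sub forF; rewrite defF; apply/subsetP => e /setIP[eG].
rewrite inE => /eqP <-; rewrite nth_index ?mem_enum ?pblock_mem ?covP //.
by rewrite mem_pblock covP.
Qed.

Lemma min_forests_colorable G : forest_colorable G (min_forests G).
Proof.
by rewrite /min_forests; case: ex_minnP => m /decomposable_colorable.
Qed.

Lemma min_forests_le G k : forest_colorable G k -> min_forests G <= k.
Proof.
case=> f [ltfk forf]; rewrite /min_forests; case: ex_minnP => m _ min_m.
pose class (i : 'I_k) := edges G :&: [set e | f e == i].
pose P := preim_partition f (edges G).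
(* The blocks of [P] are the nonempty colour classes, so there are at most [k] of them and each
   spans a forest. *)
have sP : P \subset [set class i | i in 'I_k].
  apply/subsetP => _ /imsetP[e eG ->]; apply/imsetP.
  exists (Ordinal (ltfk e eG)) => //.
  by apply/setP => e'; rewrite !inE /= eq_sym.
have leP : #|P| <= k.
  apply: leq_trans (subset_leq_card sP) _.
  by rewrite (leq_trans (leq_imset_card _ _)) ?card_ord.
apply: leq_trans leP; apply: min_m; apply/existsP; exists P.
rewrite eqxx andbT /forest_partition preim_partitionP /=.
apply/forall_inP => _ /(subsetP sP)/imsetP[i _ ->]; apply/existsP.
by exists (restrict G [set e | f e == i]); rewrite forf /=.
Qed.

Lemma forest_colorable_leq G k m : k <= m -> forest_colorable G k -> forest_colorable G m.
Proof.
move=> lekm [f [ltfk forf]]; exists f; split=> [e /ltfk lt_e | i _].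
  exact: leq_trans lt_e lekm.
have [ltik|leki] := ltnP i k; first exact: forf.
apply/is_forestP => -[|x [|y c]]; try by case/andP.
case/andP=> _ /andP[] /= /andP[/setIP[/ltfk lt_xy]].
by rewrite inE => /eqP eq_i; rewrite eq_i ltnNge leki in lt_xy.
Qed.

Lemma forest_colorable_sub K G k :
  edges K \subset edges G -> forest_colorable G k -> forest_colorable K k.
Proof.
move=> sKG [f [ltfk forf]]; exists f; split=> [e /(subsetP sKG)/ltfk // | i ltik].
by apply: is_forest_sub (forf i ltik); apply: setSI.
Qed.

Lemma forest_colorable_wedge K L v k : verts K :&: verts L \subset [set v] ->
  forest_colorable K k -> forest_colorable L k ->
  forest_colorable (graph_union K L) k.
Proof.
move=> KL_v [f [ltfk forf]] [g [ltgk forg]].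
(* A common edge would give two common vertices. *)
have disjKL e : e \in edges K -> e \notin edges L.
  move=> eK; apply/negP => eL; have := subset_leq_card KL_v.
  rewrite cards1 leqNgt -(edges_card eK) subset_leq_card //.
  by rewrite subsetI !edges_sub.
exists (fun e => if e \in edges K then f e else g e); split=> [e|i ltik].
  by case: ifP => [/ltfk // | eK /setUP[|/ltgk //]]; rewrite eK.
set X := [set e | _].
have KX : is_forest (restrict K X).
  apply: is_forest_sub (forf i ltik); apply/subsetP => e.
  by rewrite !inE => /andP[eK]; rewrite eK.
have LX : is_forest (restrict L X).
  apply: is_forest_sub (forg i ltik); apply/subsetP => e; rewrite !inE.
  case/andP=> eL; rewrite eL; case: ifP => // /disjKL.
  by rewrite eL.
have KLX : verts (restrict K X) :&: verts (restrict L X) \subset [set v] := KL_v.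
(* Each colour class of the wedge is the union of the classes of that colour in [K] and [L], hence
   itself a wedge of forests. *)
apply: is_forest_sub (wedge_forest KLX KX LX).
by rewrite /edges /= setIUl.
Qed.

Lemma min_forests_wedge K L v : verts K :&: verts L \subset [set v] ->
  min_forests (graph_union K L) = maxn (min_forests K) (min_forests L).
Proof.
move=> KL_v; apply/eqP; rewrite eqn_leq geq_max; apply/and3P; split.
- apply/min_forests_le/(forest_colorable_wedge KL_v).
    exact: forest_colorable_leq (leq_maxl _ _) (min_forests_colorable K).
  exact: forest_colorable_leq (leq_maxr _ _) (min_forests_colorable L).
(* For the lower bound, an optimal colouring of the wedge also colours each side. *)
- apply/min_forests_le/forest_colorable_sub/min_forests_colorable.
  exact: subsetUl.
- apply/min_forests_le/forest_colorable_sub/min_forests_colorable.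
  exact: subsetUr.
Qed.

(* Truncated subtraction makes the edgeless case uniform. *)
Lemma arbE G : arb G = min_forests G - 1.
Proof.
rewrite /arb; case: eqP => // G0; suff: min_forests G <= 0 by case: min_forests.
by apply: min_forests_le; exists (fun=> 0); split=> // e; rewrite G0 inE.
Qed.

End WedgeArboricity.

Theorem theorem17 (T : finType) (K L G : sgraph T) (v : T)
    (KL_v : verts K :&: verts L = [set v]) (G_wedge : G = graph_union K L) :
  arb G = maxn (arb K) (arb L).
Proof.
have sKL_v : verts K :&: verts L \subset [set v] by rewrite KL_v.
(* Truncated subtraction of one commutes with the maximum. *)
by rewrite G_wedge !arbE (min_forests_wedge sKL_v) subn_maxl.
Qed.
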